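(* Let $\tilde{\mathcal{P}}$ be a collage on the uniform space $(X,\mathcal{U}_X)$ over the directed set $(\Lambda,\leq)$. Suppose that there exists some $U\in\mathcal{U}_X$ for which $U(x)=\{y \mid (y,x)\in U\}$ is precompact (has compact closure) for each $x\in X$. Then $(\Omega^{\tilde{\mathcal{P}}},\mathcal{U}_{\Omega^{\tilde{\mathcal{P}}}})$ is a completion of $(X,\mathcal{U}_{\tilde{\mathcal{P}}})$ if the following holds: for each net $(x_\alpha)$ with $x_\alpha\in\Omega^{\tilde{\mathcal{P}}}$ and $(x_\alpha)\rightarrow x$ for some $x\in\prod_{\lambda\in\Lambda}K_\lambda$, we have that $(x_\alpha)\rightarrow l$ for some $l\in\Omega^{\tilde{\mathcal{P}}}$. In particular, if the approximants $K_\lambda$ of $\tilde{\mathcal{P}}$ are Hausdorff, then $(\Omega^{\tilde{\mathcal{P}}},\mathcal{U}_{\Omega^{\tilde{\mathcal{P}}}})$ is a completion of $(X,\mathcal{U}_{\tilde{\mathcal{P}}})$.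
   Context: For relations $U,V\subset X\times X$: $U\circ V=\{(x,z)\mid (x,y)\in U,\ (y,z)\in V\text{ for some }y\}$. For a function $f$, $f(U)=\{(f(x),f(y))\mid (x,y)\in U\}$ and $f^{-1}(V)=\{(x,y)\mid (f(x),f(y))\in V\}$. Uniform spaces are given by uniformities of entourages (upward closed) and carry the induced topology. Collage: a collage $\tilde{\mathcal{P}}$ on a uniform space $(X,\mathcal{U}_X)$ over a directed set $(\Lambda,\leq)$ consists of equivalence relations $\lambda_{\tilde{\mathcal{P}}}\subset X\times X$, one for each $\lambda\in\Lambda$, such that: (1) if $\lambda\leq\mu$ then $\mu_{\tilde{\mathcal{P}}}\subset\lambda_{\tilde{\mathcal{P}}}$; (2) for each $\lambda\in\Lambda$ there is some $\mu\geq\lambda$ such that for all $U\in\mathcal{U}_X$ there is some $V\in\mathcal{U}_X$ with $V\subset U$ and $V\circ\mu_{\tilde{\mathcal{P}}}\subset\lambda_{\tilde{\mathcal{P}}}\circ U$. The collage uniformity $\mathcal{U}_{\tilde{\mathcal{P}}}$ on $X$ is the uniformity with base the sets $U\circ\lambda_{\tilde{\mathcal{P}}}\circ U$, $\lambda\in\Lambda$, $U\in\mathcal{U}_X$. The approximant $K_\lambda=X/\lambda_{\tilde{\mathcal{P}}}$ has the quotient topology, with quotient map $\pi_{\lambda,X}\colon X\to K_\lambda$ and induced quotient maps $\pi_{\lambda,\mu}\colon K_\mu\to K_\lambda$ for $\lambda\le\mu$. $\Omega^{\tilde{\mathcal{P}}}=\varprojlim(K_\lambda,\pi_{\lambda,\mu})\subset\prod_\lambda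 K_\lambda$ (with the subspace topology), with projections $\pi_{\lambda,\infty}\colon\Omega^{\tilde{\mathcal{P}}}\to K_\lambda$. The uniformity $\mathcal{U}_{\Omega^{\tilde{\mathcal{P}}}}$ on $\Omega^{\tilde{\mathcal{P}}}$ is the upwards closure of the collection of sets $\pi_{\lambda,\infty}^{-1}(\pi_{\lambda,X}(U))$, $\lambda\in\Lambda$, $U\in\mathcal{U}_X$; it induces the inverse limit topology. Completion: $(Y,\mathcal{U}_Y)$ (not necessarily Hausdorff) is a completion of $(X,\mathcal{U})$ if there is a uniformly continuous map $i\colon(X,\mathcal{U})\to(Y,\mathcal{U}_Y)$ such that the composition of $i$ with the Kolmogorov quotient map $(Y,\mathcal{U}_Y)\to(Y,\mathcal{U}_Y)^{KQ}$ is a Hausdorff completion of $(X,\mathcal{U})$. *)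

(* Defs.v *)
From HB Require Import structures.
From mathcomp Require Import all_boot all_order all_classical.
From mathcomp Require Import topology.

Set Implicit Arguments.
Unset Strict Implicit.
Unset Printing Implicit Defensive.

Import Order.PreorderTheory.
Local Open Scope classical_set_scope.
Local Open Scope relation_scope.
Local Open Scope quotient_scope.

HB.mixin Record Preorder_isDirected (d : Order.disp_t) T
    of Order.Preorder d T := {
  directed_inhabited : inhabited T ;
  directed_ub : forall x y : T, exists z : T, (x <= z)%O /\ (y <= z)%O
}.

#[short(type="directedType")]
HB.structure Definition Directed (d : Order.disp_t) :=
  {T of Order.Preorder d T & Preorder_isDirected d T}.

(* The filter of tails: a net [x : A -> T] converges to [t] iff
   [x @ tails A --> t]. *)
Definition tails (d : Order.disp_t) (A : directedType d) : set_system A :=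
  filter_from setT (fun a => [set b | (a <= b)%O]).
Arguments tails {d} A.

Definition pairmap {S T : Type} (f : S -> T) (xy : S * S) : T * T :=
  (f xy.1, f xy.2).

(* Composition in diagrammatic order. The library's [B \; A] applies [A] first,
   so [U \then V] is [V \; U]. *)
Definition relcomp {T : Type} (U V : set (T * T)) : set (T * T) :=
  [set xz | exists2 y, U (xz.1, y) & V (y, xz.2)].
Notation "U \then V" := (relcomp U V) (at level 40, left associativity).

Definition graph {T : Type} (r : rel T) : set (T * T) :=
  [set xy | r xy.1 xy.2].

Section Completions.

(* The library's [completeType] is restricted to pointed types, which would
   exclude the empty space. *)
Definition complete_space (T : uniformType) : Prop :=
  forall F : set_system T, ProperFilter F -> cauchy F ->
    exists x : T, F --> x.

Definition is_hausdorff_completion (X Y : uniformType) (i : X -> Y) : Prop :=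
  [/\ unif_continuous i, hausdorff_space Y, complete_space Y &
    forall (Z : uniformType) (f : X -> Z),
      hausdorff_space Z -> complete_space Z -> unif_continuous f ->
      exists! g : Y -> Z, unif_continuous g /\ g \o i = f].

Variable Y : uniformType.

Definition indistinguishable (x y : Y) : bool := `[< nbhs x = nbhs y >].

Lemma indistinguishable_refl : reflexive indistinguishable.
Proof. by move=> x; apply/asboolP. Qed.

Lemma indistinguishable_sym : symmetric indistinguishable.
Proof. by move=> x y; apply/asboolP/asboolP => ->. Qed.

Lemma indistinguishable_trans : transitive indistinguishable.
Proof. by move=> y x z /asboolP xy /asboolP yz; apply/asboolP; rewrite xy. Qed.

Canonical indistinguishable_equiv := EquivRel indistinguishable
  indistinguishable_refl indistinguishable_sym indistinguishable_trans.

Definition kolmogorov_quotient : Type := {eq_quot indistinguishable}.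

HB.instance Definition _ := Choice.on kolmogorov_quotient.

Definition kolmogorov_pi : Y -> kolmogorov_quotient :=
  \pi_{eq_quot indistinguishable}.

Definition kolmogorov_ent :
    set_system (kolmogorov_quotient * kolmogorov_quotient) :=
  [set W | entourage (pairmap kolmogorov_pi @^-1` W)].

Let kolmogorov_pi_surj (q : kolmogorov_quotient) :
  exists y, kolmogorov_pi y = q.
Proof. by exists (repr (q : {eq_quot indistinguishable})); exact: reprK. Qed.

Let kolmogorov_ent_filter : Filter kolmogorov_ent.
Proof.
rewrite /kolmogorov_ent; split => /=.
- exact: filterT.
- by move=> P Q; exact: filterI.
- by move=> P Q PQ; apply: filterS => xy; exact: PQ.
Qed.

Let kolmogorov_ent_diagonal W : kolmogorov_ent W -> diagonal `<=` W.
Proof.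
move=> Went [p q] /= /diagonalP <-; have [y <-] := kolmogorov_pi_surj p.
exact: entourage_refl y Went.
Qed.

Let kolmogorov_ent_inv W : kolmogorov_ent W -> kolmogorov_ent W^-1.
Proof. exact: entourage_inv. Qed.

Let kolmogorov_ent_split W : kolmogorov_ent W ->
  exists2 B, kolmogorov_ent B & B \; B `<=` W.
Proof.
move=> Went.
pose E := split_ent (split_ent (pairmap kolmogorov_pi @^-1` W)).
have entE : entourage E by do 2 apply: entourage_split_ent.
exists (pairmap kolmogorov_pi @` E).
  by apply: filterS entE => xy Exy; exists xy.
move=> [p r] /= [q [[x y] Exy [<- xq]] [[y' z] Ey'z [y'q <-]]] /=.
have /asboolP yy' : indistinguishable y y'.
  have /eqmodP := etrans xq (esym y'q); exact.
have Eyy' : E (y, y').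
  have : nbhs y (xsection E y) by exact: nbhs_entourage.
  by rewrite yy' => /nbhs_singleton/xsectionP.
apply: (entourage_split y' Went); last first.
  by apply: split_ent_subset => //; exact: entourage_split_ent.
by apply: (entourage_split y) => //; exact: entourage_split_ent.
Qed.

HB.instance Definition _ := @isUniform.Build kolmogorov_quotient
  kolmogorov_ent kolmogorov_ent_filter kolmogorov_ent_diagonal
  kolmogorov_ent_inv kolmogorov_ent_split.

End Completions.

Definition is_completion (X Y : uniformType) : Prop :=
  exists i : X -> Y, unif_continuous i /\
    is_hausdorff_completion (@kolmogorov_pi Y \o i).
Arguments is_completion : clear implicits.

Record collage (X : uniformType) (d : Order.disp_t) (L : directedType d) :=
  Collage {
    collage_rel :> L -> equiv_rel X ;
    collage_antitone : forall l m : L, (l <= m)%O ->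
      graph (collage_rel m) `<=` graph (collage_rel l) ;
    collage_exchange : forall l : L, exists2 m : L, (l <= m)%O &
      forall U : set (X * X), entourage U ->
        exists V : set (X * X), [/\ entourage V, V `<=` U &
          V \then graph (collage_rel m) `<=` graph (collage_rel l) \then U]
  }.

Section CollageSpaces.
Variables (X : uniformType) (d : Order.disp_t) (L : directedType d).
Variable P : collage X L.

(* [X] with the collage uniformity instead of its own. *)
Definition collage_space (Q : collage X L) : Type := X.

HB.instance Definition _ := Choice.on (collage_space P).

Definition collage_ent : set_system (collage_space P * collage_space P) :=
  [set W | exists l : L, exists2 U : set (X * X), entourage U &
    U \then graph (P l) \then U `<=` W].

Let collage_ent_filter : Filter collage_ent.
Proof.
split => /=.
- have [l] := @directed_inhabited _ L.
  by exists l; exists setT => //; exact: filterT.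
- move=> A B [l [U entU UA]] [m [V entV VB]].
  have [n [ln mn]] := directed_ub l m.
  exists n; exists (U `&` V); first exact: filterI.
  move=> [x t] /= [z [y [Uxy Vxy] Pyz] [Uzt Vzt]]; split.
    apply: UA; exists z => //; exists y => //.
    exact: (collage_antitone ln Pyz).
  apply: VB; exists z => //; exists y => //.
  exact: (collage_antitone mn Pyz).
- by move=> A B AB [l [U entU UA]]; exists l; exists U => // xy /UA/AB.
Qed.

Let collage_ent_diagonal W : collage_ent W -> diagonal `<=` W.
Proof.
move=> [l [U entU UW]] [x y] /= /diagonalP <-; apply: UW.
exists x; last exact: entourage_refl.
by exists x; [exact: entourage_refl | rewrite /graph /= equiv_refl].
Qed.

Let collage_ent_inv W : collage_ent W -> collage_ent W^-1.
Proof.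
move=> [l [U entU UW]]; exists l; exists U^-1; first exact: entourage_inv.
move=> [x t] /= [z [y Uyx Pyz] Utz]; apply: UW => /=.
by exists y => //; exists z => //; rewrite /graph /= equiv_sym.
Qed.

Let collage_ent_split W : collage_ent W ->
  exists2 B, collage_ent B & B \; B `<=` W.
Proof.
move=> [l [U entU UW]]; have [m lm exm] := collage_exchange P l.
have [V [entV VU VE]] := exm _ (entourage_split_ent entU).
exists (split_ent V \then graph (P m) \then split_ent V).
  by exists m; exists (split_ent V) => //; exact: entourage_split_ent.
move=> [x t] /= [z [c [b Vxb Pbc] Vcz] [e [f Vzf Pfe] Vet]]; apply: UW.
have Vcf : V (c, f) by exact: (entourage_split z).
have [g Pcg Uge] : (graph (P l) \then split_ent U) (c, e).
  by apply: VE; exists f.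
have sVU : split_ent V `<=` split_ent U.
  by move=> p Vp; apply: VU; exact: split_ent_subset.
exists g; last by apply: (entourage_split e) => //; exact: sVU.
exists b; first by apply: split_ent_subset => //; exact: sVU.
by apply: equiv_trans Pcg; exact: (collage_antitone lm Pbc).
Qed.

HB.instance Definition _ := @isUniform.Build (collage_space P)
  collage_ent
  collage_ent_filter collage_ent_diagonal collage_ent_inv collage_ent_split.

Definition approximant (l : L) : topologicalType :=
  quotient_topology {eq_quot P l}.

Definition approximant_pi (l : L) : X -> approximant l :=
  \pi_(quotient_topology {eq_quot P l}).

(* Meaningful for [l <= m] only, where it is independent of the representative;
   see [bondE]. *)
Definition bond (l m : L) (k : approximant m) : approximant l :=
  approximant_pi l (repr (k : quotient_topology {eq_quot P m})).

Lemma approximant_piP (l : L) (x y : X) :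
  approximant_pi l x = approximant_pi l y <-> graph (P l) (x, y).
Proof. by split => [/eqmodP|Pxy]; [|apply/eqmodP]. Qed.

Lemma approximant_pi_surj (l : L) (k : approximant l) :
  exists x, approximant_pi l x = k.
Proof. by exists (repr (k : quotient_topology {eq_quot P l})); exact: reprK. Qed.

Lemma bondE (l m : L) (x : X) : (l <= m)%O ->
  bond l (approximant_pi m x) = approximant_pi l x.
Proof.
move=> lm; apply/approximant_piP; apply: (collage_antitone lm).
by apply/approximant_piP; exact: reprK.
Qed.

Definition inverse_limit : set (prod_topology approximant) :=
  [set x | forall l m : L, (l <= m)%O -> bond l (x m) = x l].

Definition limit_space : Type := set_type inverse_limit.

HB.instance Definition _ := Choice.on limit_space.

Definition limit_proj (l : L) (x : limit_space) : approximant l := set_val x l.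

Definition limit_ent : set_system (limit_space * limit_space) :=
  [set W | exists l : L, exists2 U : set (X * X), entourage U &
    pairmap (limit_proj l) @^-1` (pairmap (approximant_pi l) @` U) `<=` W].

Let limit_proj_bond (l m : L) (x : limit_space) (a : X) : (l <= m)%O ->
  approximant_pi m a = limit_proj m x -> approximant_pi l a = limit_proj l x.
Proof.
move=> lm ax; rewrite -(bondE a lm) ax.
by have /set_mem := valP x; exact.
Qed.

Let limit_ent_filter : Filter limit_ent.
Proof.
split => /=.
- have [l] := @directed_inhabited _ L.
  by exists l; exists setT => //; exact: filterT.
- move=> A B [l [U entU UA]] [m [V entV VB]].
  have [n [ln mn]] := directed_ub l m.
  exists n; exists (U `&` V); first exact: filterI.
  move=> [x y] /= [[a b] [Uab Vab] [ax by_]]; split.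
    by apply: UA; exists (a, b) => //; congr pair; exact: (limit_proj_bond ln).
  by apply: VB; exists (a, b) => //; congr pair; exact: (limit_proj_bond mn).
- by move=> A B AB [l [U entU UA]]; exists l; exists U => // xy /UA/AB.
Qed.

Let limit_ent_diagonal W : limit_ent W -> diagonal `<=` W.
Proof.
move=> [l [U entU UW]] [x y] /= /diagonalP <-; apply: UW.
have [a ax] := approximant_pi_surj (limit_proj l x).
by exists (a, a); [exact: entourage_refl | rewrite /pairmap /= ax].
Qed.

Let limit_ent_inv W : limit_ent W -> limit_ent W^-1.
Proof.
move=> [l [U entU UW]]; exists l; exists U^-1; first exact: entourage_inv.
by move=> [x y] /= [[a b] Uba [ax by_]]; apply: UW; exists (b, a) => //; congr pair.
Qed.

Let limit_ent_split W : limit_ent W -> exists2 B, limit_ent B & B \; B `<=` W.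
Proof.
move=> [l [U entU UW]]; have [m lm exm] := collage_exchange P l.
have [V [entV VU VE]] := exm _ (entourage_split_ent entU).
exists (pairmap (limit_proj m) @^-1` (pairmap (approximant_pi m) @` V)).
  by exists m; exists V.
move=> [x z] /= [y [[a b] Vab [ax by_]] [[c e] Vce [cy ez]]]; apply: UW.
have [g Pag Ugc] : (graph (P l) \then split_ent U) (a, c).
  by apply: VE; exists b => //; apply/approximant_piP; rewrite /= by_ cy.
exists (g, e); first by apply: (entourage_split c) => //; exact: VU.
congr pair; last exact: (limit_proj_bond lm).
have /approximant_piP <- := Pag; exact: (limit_proj_bond lm).
Qed.

HB.instance Definition _ := @isUniform.Build limit_space limit_ent
  limit_ent_filter limit_ent_diagonal limit_ent_inv limit_ent_split.

End CollageSpaces.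
Arguments approximant_pi {X d L} P l _.
Arguments inverse_limit {X d L} P _.
Arguments limit_proj {X d L} P l _.

(* Main.v *)
(* The map [i : X -> Omega] has dense image, and the exchange condition makes
   the collage uniformity the one induced by [i]; so it is enough that [Omega]
   is complete, completeness passing to the Kolmogorov quotient.

   Let [F] be a Cauchy filter on [Omega] and [G] a finer ultrafilter. By the
   exchange condition and precompactness of the [U(x)], each projection of [G]
   to [K_l] contains the image of a compact set, hence converges. Thus [G]
   converges in the product of the [K_l] and, read as a net, converges by
   hypothesis to a point of [Omega] in the product topology. Entourage
   neighbourhoods of a point of [Omega] are neighbourhoods for the product
   topology, so [G], and with it [F], converges in [Omega]. *)

From Pilot Require Import Defs.
From HB Require Import structures.
From mathcomp Require Import all_boot all_order all_classical.
From mathcomp Require Import topology.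
(* [seq.pairmap] would otherwise shadow [Defs.pairmap]. *)
Import Pilot.Defs.

Local Open Scope classical_set_scope.
Local Open Scope relation_scope.

Set Implicit Arguments.
Unset Strict Implicit.
Unset Printing Implicit Defensive.

(** * Extension of uniformly continuous maps and Hausdorff completions *)

Section UniformSpaces.

Lemma unif_continuousE (X Y : uniformType) (f : X -> Y) (E : set (Y * Y)) :
  unif_continuous f -> entourage E -> entourage (pairmap f @^-1` E).
Proof. exact. Qed.

Lemma entourage_split_sym (X : uniformType) (E : set (X * X)) :
  entourage E ->
  exists D : set (X * X), [/\ entourage D, D `<=` E,
    forall x y, D (x, y) -> D (y, x) &
    forall x y z, D (x, y) -> D (y, z) -> E (x, z)].
Proof.
move=> entE; exists (split_ent E `&` (split_ent E)^-1); split.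
- by apply: filterI.
- by move=> p [Ep _]; exact: split_ent_subset.
- by move=> x y [].
- by move=> x y z [Exy _] [Eyz _]; exact: (entourage_split y).
Qed.

Lemma hausdorff_entourage_eq (Z : uniformType) (x y : Z) :
  hausdorff_space Z -> (forall E, entourage E -> E (x, y)) -> x = y.
Proof. by move=> hZ xy; apply: (close_eq hZ); rewrite entourage_close. Qed.

Lemma cauchyP (T : uniformType) (F : set_system T) : Filter F ->
  cauchy F <-> forall E, entourage E ->
    exists2 A, F A & forall x y, A x -> A y -> E (x, y).
Proof.
move=> FF; split=> [cF E /cF [[A B] /= [FA FB] ABE]|cF E /cF [A FA AE]].
  exists (A `&` B); first exact: filterI.
  by move=> x y [Ax _] [_ By]; exact: (ABE (x, y)).
by exists (A, A) => // -[x y] /= [Ax Ay]; exact: AE.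
Qed.

Section Extension.
Variables (X Q Z : uniformType) (j : X -> Q) (f : X -> Z).
Hypothesis j_dense : forall q (E : set (Q * Q)), entourage E ->
  exists x, E (q, j x).
Hypothesis j_inducing : forall E : set (X * X), entourage E ->
  exists2 W, entourage W & pairmap j @^-1` W `<=` E.
Hypothesis Z_hausdorff : hausdorff_space Z.
Hypothesis Z_complete : complete_space Z.
Hypothesis f_uc : unif_continuous f.

(** The value at [q] is a limit of [f] along [N q], the trace on [X] of the neighbourhood filter of
    [q]: density makes this filter proper, and [j_inducing] makes its image under [f] Cauchy. *)
Lemma unif_continuous_extension :
  exists g : Q -> Z, unif_continuous g /\ g \o j = f.
Proof.
pose N q := filter_from (@entourage Q) (fun E => [set x | E (q, j x)]).
have NF q : ProperFilter (N q).
  apply: filter_from_proper => [|E /(j_dense q)//].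
  apply: filter_from_filter; first by exists setT; exact: filterT.
  by move=> E D entE entD; exists (E `&` D) => //; exact: filterI.
have lim q : exists z : Z, f @ N q --> z.
  apply: Z_complete; apply/cauchyP => E entE.
  have [W entW WE] := j_inducing (unif_continuousE f_uc entE).
  have [D [entD _ Dsym DW]] := entourage_split_sym entW.
  exists (f @` [set x | D (q, j x)]).
    by exists D => // x Dx; exists x.
  move=> _ _ [x Dx <-] [y Dy <-]; apply: (WE (x, y)).
  by apply: DW Dy; exact: Dsym.
have [g fg] := choice lim.
(* The entourage [W] is uniform in [q]. This gives both the uniform continuity of [g] and, by
   separation of [Z], the equation [g \o j = f]. *)
have near_g E : entourage E ->
    exists2 W, entourage W & forall q x, W (q, j x) -> E (g q, f x).
  move=> entE; have [E1 [entE1 _ _ E1E]] := entourage_split_sym entE.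
  have [W entW WE] := j_inducing (unif_continuousE f_uc entE1).
  have [D [entD _ Dsym DW]] := entourage_split_sym entW.
  exists D => // q x Dqx.
  have gE1 : N q [set y | E1 (g q, f y)].
    by have /cvg_app_entourageP := fg q; exact.
  have ND : N q [set y | D (q, j y)] by exists D.
  have [y [gfy Dqy]] := filter_ex (filterI gE1 ND).
  apply: E1E gfy _; apply: (WE (y, x)).
  by apply: DW Dqx; exact: Dsym.
exists g; split; last first.
  apply/funext => x; apply: hausdorff_entourage_eq => // E /near_g[W entW].
  by apply; exact: entourage_refl.
move=> E entE; have [E1 [entE1 _ E1sym E1E]] := entourage_split_sym entE.
have [W entW WE1] := near_g _ entE1.
have [D [entD DW Dsym DDW]] := entourage_split_sym entW.
apply: filterS (entD) => -[p q] Dpq.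
have [x Dqx] := j_dense q entD.
apply: (E1E _ (f x)); first by apply: WE1; exact: DDW Dpq Dqx.
by apply: E1sym; apply: WE1; exact: DW.
Qed.

Lemma unif_continuous_eq_dense (g h : Q -> Z) :
  unif_continuous g -> unif_continuous h -> g \o j = h \o j -> g = h.
Proof.
move=> gu hu gh; apply/funext => q; apply: hausdorff_entourage_eq => // E entE.
have [D [entD _ Dsym DE]] := entourage_split_sym entE.
have [x [gD hD]] := j_dense q
  (filterI (unif_continuousE gu entD) (unif_continuousE hu entD)).
apply: DE gD _; apply: Dsym.
by rewrite /= (congr1 (@^~ x) gh : g (j x) = h (j x)).
Qed.

End Extension.

Lemma hausdorff_completion_criterion (X Q : uniformType) (j : X -> Q) :
  unif_continuous j -> hausdorff_space Q -> complete_space Q ->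
  (forall q (E : set (Q * Q)), entourage E -> exists x, E (q, j x)) ->
  (forall E : set (X * X), entourage E ->
     exists2 W, entourage W & pairmap j @^-1` W `<=` E) ->
  is_hausdorff_completion j.
Proof.
move=> ju Qh Qc jd ji; split=> // Z f Zh Zc fu.
have [g [gu gf]] := unif_continuous_extension jd ji Zh Zc fu.
exists g; split=> // h [hu hf].
by apply: (unif_continuous_eq_dense jd Zh gu hu); rewrite gf hf.
Qed.

End UniformSpaces.

(** * Separation and completeness of the Kolmogorov quotient *)

Section KolmogorovQuotient.
Variable Y : uniformType.

Local Notation kpi := (@kolmogorov_pi Y).

Lemma kolmogorov_pi_surjective (q : kolmogorov_quotient Y) :
  exists y, kpi y = q.
Proof.
by exists (repr (q : {eq_quot @indistinguishable Y})%qT); exact: reprK.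
Qed.

Lemma kolmogorov_piP (x y : Y) : kpi x = kpi y <-> nbhs x = nbhs y.
Proof.
split=> [/eqmodP|xy]; first by move/asboolP.
by apply/eqmodP/asboolP.
Qed.

Lemma kolmogorov_entourageE
    (W : set (kolmogorov_quotient Y * kolmogorov_quotient Y)) :
  entourage W = entourage (pairmap kpi @^-1` W).
Proof. by []. Qed.

(** Indistinguishable points are related by every entourage, so moving both ends of a pair in a
    small entourage [B] to indistinguishable points stays within [E]. *)
Lemma kolmogorov_entourage_lift (E : set (Y * Y)) : entourage E ->
  exists2 W, entourage W & pairmap kpi @^-1` W `<=` E.
Proof.
move=> entE; have [D [entD _ _ DE]] := entourage_split_sym entE.
have close x y : nbhs x = nbhs y -> forall B, entourage B -> B (x, y).
  move=> xy B entB; have : nbhs x (xsection B x) by exact: nbhs_entourage.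
  by rewrite xy => /nbhs_singleton/xsectionP.
have [B [entB _ _ BD]] := entourage_split_sym entD.
exists (pairmap kpi @` B).
  by rewrite kolmogorov_entourageE; apply: filterS entB => p Bp; exists p.
move=> [x y] [[a b] Bab [/kolmogorov_piP ax /kolmogorov_piP by_]].
apply: (DE x b); last exact: close.
by apply: (BD x a) => //; exact: close.
Qed.

(** Closeness in the quotient lifts to [Y], where close points have the same neighbourhoods. *)
Lemma kolmogorov_hausdorff : hausdorff_space (kolmogorov_quotient Y).
Proof.
move=> p q pq; have {pq} : close p q by rewrite closeEnbhs.
have [x <-] := kolmogorov_pi_surjective p.
have [y <-] := kolmogorov_pi_surjective q.
rewrite entourage_close => xy; apply/kolmogorov_piP.
suff xy_close : close x y.
  by apply/seteqP; split; apply: close_cvgxx => //; exact: close_sym.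
rewrite entourage_close => E /kolmogorov_entourage_lift[W entW].
by apply; exact: xy.
Qed.

(** The preimages under [kpi] of the sets of a Cauchy filter generate a Cauchy filter on [Y]; the
    class of a limit of the latter is a limit of the former. *)
Lemma kolmogorov_complete :
  complete_space Y -> complete_space (kolmogorov_quotient Y).
Proof.
move=> Yc F FF /cauchyP cF.
pose G := filter_from F (fun A => kpi @^-1` A).
have GF : ProperFilter G.
  apply: filter_from_proper => [|A /filter_ex[q Aq]]; last first.
    by have [y yq] := kolmogorov_pi_surjective q; exists y; rewrite /= yq.
  apply: filter_from_filter; first by exists setT; exact: filterT.
  by move=> A B FA FB; exists (A `&` B) => //; exact: filterI.
have [|y Gy] := Yc G GF.
  apply/cauchyP => E /kolmogorov_entourage_lift[W entW WE].
  have [A FA AW] := cF W entW.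
  exists (kpi @^-1` A); first by exists A.
  by move=> x z Ax Az; apply: (WE (x, z)); exact: AW.
exists (kpi y); apply/cvg_entourageP => W entW.
have /cvg_entourageP/(_ _ entW)[A FA AW] := Gy.
apply: filterS FA => q Aq; have [z zq] := kolmogorov_pi_surjective q.
by rewrite -zq; apply: AW; rewrite /= zq.
Qed.

End KolmogorovQuotient.

Lemma completion_criterion (X Y : uniformType) (i : X -> Y) :
  unif_continuous i -> complete_space Y ->
  (forall y (E : set (Y * Y)), entourage E -> exists x, E (y, i x)) ->
  (forall E : set (X * X), entourage E ->
     exists2 W, entourage W & pairmap i @^-1` W `<=` E) ->
  is_completion X Y.
Proof.
move=> iu Yc id ii; exists i; split=> //.
apply: hausdorff_completion_criterion.
- by move=> W entW; exact: (iu _ entW).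
- exact: kolmogorov_hausdorff.
- exact: kolmogorov_complete.
- move=> q W entW; have [y <-] := kolmogorov_pi_surjective q.
  exact: (id y _ entW).
- move=> E /ii[D /kolmogorov_entourage_lift[W entW WD] DE].
  by exists W => // -[x y] Wxy; apply: DE; exact: WD.
Qed.

(** * Nets associated with filters *)

Section FilterNet.
Variables (T : Type) (F : set_system T).

(** Completeness is about filters while the hypothesis on the inverse limit is about nets; this is
    the index set of the usual translation. [FF] indexes the type because directedness, attached to
    it as an instance, rests on [F] being proper. *)
Definition filter_net (FF : ProperFilter F) : Type :=
  {p : set T * T | F p.1 /\ p.1 p.2}.

Variable FF : ProperFilter F.

Definition net_point (a : filter_net FF) : T := (sval a).2.

HB.instance Definition _ := gen_eqMixin (filter_net FF).
HB.instance Definition _ := gen_choiceMixin (filter_net FF).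

Definition net_le (a b : filter_net FF) : bool :=
  `[< (sval b).1 `<=` (sval a).1 >].

Let net_le_refl : reflexive net_le.
Proof. by move=> a; apply/asboolP. Qed.

Let net_le_trans : transitive net_le.
Proof.
by move=> b a c /asboolP ba /asboolP cb; apply/asboolP => x /cb/ba.
Qed.

HB.instance Definition _ := @Order.Le_isPreorder.Build (Order.Disp tt tt)
  (filter_net FF) net_le net_le_refl net_le_trans.

Let net_inhabited : inhabited (filter_net FF).
Proof.
have [x _] := filter_ex (@filterT _ F _).
by split; exists (setT, x); split => //; exact: filterT.
Qed.

Let net_ub (a b : filter_net FF) :
  exists c : filter_net FF, (a <= c)%O /\ (b <= c)%O.
Proof.
case: a b => -[A x] [/= FA Ax] [[B y] [/= FB By]].
have FAB : F (A `&` B) by exact: filterI.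
have [z ABz] := filter_ex FAB.
exists (exist _ (A `&` B, z) (conj FAB ABz)).
by split; apply/asboolP => t [].
Qed.

HB.instance Definition _ := @Preorder_isDirected.Build (Order.Disp tt tt)
  (filter_net FF) net_inhabited net_ub.

(** Each point of a set [A] of [F] is itself paired with [A], so the tail from [(A, x)] takes
    exactly the values in [A]. *)
Lemma net_point_tails : net_point @ tails (filter_net FF) = F.
Proof.
apply/seteqP; split=> A.
  move=> [[[B x] [/= FB Bx]] _ BA]; apply: filterS (FB) => y By.
  by apply: (BA (exist _ (B, y) (conj FB By))); apply/asboolP.
move=> FA; have [x Ax] := filter_ex FA.
exists (exist _ (A, x) (conj FA Ax)) => // -[[B y] [/= FB By]].
by move=> /asboolP; exact.
Qed.

End FilterNet.

Instance tails_filter (d : Order.disp_t) (A : directedType d) :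
  ProperFilter (tails A).
Proof.
apply: filter_from_proper => [|a _]; last first.
  by exists a => /=; exact: Order.PreorderTheory.lexx.
apply: filter_from_filter.
  by have [a] := @directed_inhabited _ A; exists a.
move=> a b _ _; have [c [ac bc]] := directed_ub a b.
by exists c => // t ct; split; exact: Order.PreorderTheory.le_trans ct.
Qed.

Lemma prod_topology_cvgP (I : eqType) (T : Type) (K : I -> topologicalType)
    (x : T -> prod_topology K) (F : set_system T) (y : prod_topology K) :
  Filter F -> x @ F --> y <-> forall i, (fun t => x t i) @ F --> y i.
Proof.
move=> FF; split=> [xy i|xy].
  exact: (cvg_comp _ _ xy (@proj_continuous _ _ i y)).
apply/cvg_sup => i N; rewrite nbhsE => -[_ [[B oB <-] By]] BN.
have Bx : \forall t \near F, B (x t i) by apply: xy; exact: open_nbhs_nbhs.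
by apply: filterS Bx => t; exact: BN.
Qed.

(** * Completeness of the inverse limit and the map into it *)

Section CollageLimit.
Variables (X : uniformType) (d : Order.disp_t) (L : directedType d).
Variable P : collage X L.

(** Every later use of the exchange condition is pointwise: a small step moves past an
    identification, at the cost of coarsening the latter from [m] to [l]. *)
Lemma collage_exchange_pi (l : L) : exists2 m : L, (l <= m)%O &
  forall U : set (X * X), entourage U -> exists2 V : set (X * X),
    entourage V & forall x y z, V (x, y) ->
      approximant_pi P m y = approximant_pi P m z ->
      exists2 w, approximant_pi P l x = approximant_pi P l w & U (w, z).
Proof.
have [m lm exm] := collage_exchange P l; exists m => // U /exm[V [entV _ VU]].
exists V => // x y z Vxy /approximant_piP yz.
have [w xw Uwz] : (graph (P l) \then U) (x, z) by apply: VU; exists y.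
by exists w => //; apply/approximant_piP.
Qed.

Lemma bond_continuous (l m : L) : (l <= m)%O ->
  continuous (@bond _ _ _ P l m).
Proof.
move=> lm; apply: (@repr_comp_continuous _ _ _ (approximant_pi P l)).
  exact: pi_continuous.
move=> a b /eqP ab; apply/eqP.
have : approximant_pi P l a = approximant_pi P l b.
  by rewrite -!(bondE _ _ lm); congr bond.
exact.
Qed.

Lemma bond_limit_proj (l m : L) (x : limit_space P) : (l <= m)%O ->
  bond l (limit_proj P m x) = limit_proj P l x.
Proof. by move=> lm; have /set_mem := valP x; exact. Qed.

Lemma limit_proj_le (l m : L) (x : limit_space P) (a : X) : (l <= m)%O ->
  approximant_pi P m a = limit_proj P m x ->
  approximant_pi P l a = limit_proj P l x.
Proof. by move=> lm ax; rewrite -(bondE P a lm) ax bond_limit_proj. Qed.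

(* The interior of an [l]-saturated set is saturated for the finer index [m] of
   the exchange condition, hence the preimage of an open set of [K_m]. *)
Lemma nbhs_limit_proj (l : L) (U : set (X * X)) (x : limit_space P) :
  entourage U -> exists2 m : L, (l <= m)%O &
  nbhs (limit_proj P m x) [set k | exists2 ab : X * X, U ab &
    approximant_pi P l ab.1 = limit_proj P l x /\
    approximant_pi P l ab.2 = bond l k].
Proof.
move=> entU; have [m lm exm] := collage_exchange_pi l; exists m => //.
pose S := [set y | exists2 ab : X * X, U ab &
  approximant_pi P l ab.1 = limit_proj P l x /\
  approximant_pi P l ab.2 = approximant_pi P l y].
pose O : set (approximant P m) :=
  [set k | exists2 y, S° y & approximant_pi P m y = k].
have S_sat y z : approximant_pi P l y = approximant_pi P l z -> S y -> S z.
  by move=> yz [ab Uab [ax by_]]; exists ab => //; split=> //; rewrite by_.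
have int_sat y z : approximant_pi P m y = approximant_pi P m z -> S° y -> S° z.
  rewrite /interior => yz /nbhsP[W entW WS].
  have [W1 [entW1 W1W W1sym _]] := entourage_split_sym entW.
  have [V entV VW] := exm _ entW1.
  apply/nbhsP; exists V^-1; first exact: entourage_inv.
  move=> t /xsectionP Vtz.
  have [w tw Wwy] := VW _ _ _ Vtz (esym yz).
  by apply: S_sat (esym tw) _; apply: WS; apply/xsectionP/W1W/W1sym.
have O_open : open O.
  rewrite /open /= /quotient_open.
  suff -> : \pi_(approximant P m)%qT @^-1` O = S° by exact: open_interior.
  apply/seteqP; split=> [y [z Sz zy]|y Sy]; last by exists y.
  exact: int_sat Sz.
have [a ax] := approximant_pi_surj (limit_proj P m x).
have Ox : O (limit_proj P m x).
  exists a => //; rewrite /interior.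
  apply/nbhsP; exists U => // y /xsectionP Uay.
  by exists (a, y) => //; split=> //; exact: limit_proj_le ax.
apply: filterS (open_nbhs_nbhs (conj O_open Ox)) => k.
move=> [y /interior_subset[ab Uab [ax' by_]] <-].
by exists ab => //; split=> //; rewrite bondE.
Qed.

(** By [nbhs_limit_proj], a basic entourage neighbourhood at index [l] is controlled by the single
    coordinate [m]. *)
Lemma cvg_limit_space (F : set_system (limit_space P)) (x : limit_space P) :
  Filter F -> (forall l, limit_proj P l @ F --> limit_proj P l x) -> F --> x.
Proof.
move=> FF Fx; apply/cvg_entourageP => W [l [U entU UW]].
have [m lm /Fx FU] := nbhs_limit_proj l x entU.
apply: (@filterS _ F _ _ _ _ FU) => y [[a b] /= Uab [ax]].
rewrite bond_limit_proj // => by_.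
by apply: UW; exists (a, b) => //; congr pair.
Qed.

(** Fix a point of a [V]-small set of [F] and a representative [c] of its coordinate at [m]. The
    exchange condition gives every other point of that set a representative at [l] lying in [U(c)],
    so [C] is the closure of [U(c)]. *)
Lemma cauchy_limit_proj_compact (F : set_system (limit_space P)) :
  (exists2 U : set (X * X), entourage U &
     forall x : X, precompact [set y | U (y, x)]) ->
  ProperFilter F -> cauchy F -> forall l : L,
  exists2 C : set X, compact C &
    F (limit_proj P l @^-1` (approximant_pi P l @` C)).
Proof.
move=> [U entU Upc] FF /cauchyP cF l.
have [m lm exm] := collage_exchange_pi l.
have [V entV VU] := exm U entU.
have [|A FA AV] := cF (pairmap (limit_proj P m) @^-1`
    (pairmap (approximant_pi P m) @` V)).
  by exists m; exists V.
have [x Ax] := filter_ex FA.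
have [c cx] := approximant_pi_surj (limit_proj P m x).
exists (closure [set y | U (y, c)]); first by rewrite -precompactE.
apply: filterS FA => y Ay; have [[a b] Vab [ay bx]] := AV y x Ay Ax.
have [w aw Uwc] := VU a b c Vab (etrans bx (esym cx)).
exists w; first exact: subset_closure.
by rewrite -aw; exact: limit_proj_le ay.
Qed.

(** The image of [C] is compact, and an ultrafilter converges to each of its cluster points. *)
Lemma ultra_limit_proj_cvg (G : set_system (limit_space P)) (l : L)
    (C : set X) :
  UltraFilter G -> compact C ->
  G (limit_proj P l @^-1` (approximant_pi P l @` C)) ->
  exists k : approximant P l, limit_proj P l @ G --> k.
Proof.
move=> GU Cc GC.
have Ic : compact (approximant_pi P l @` C).
  apply: continuous_compact => //; apply: continuous_subspaceT.
  exact: pi_continuous.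
have [k [_ Gk]] := Ic (limit_proj P l @ G) _ GC.
exists k => N Nk; have [//|GN] := in_ultra_setVsetC (limit_proj P l @^-1` N) GU.
by have [t []] := Gk (~` N) N GN Nk.
Qed.

Lemma limit_space_complete :
  (exists2 U : set (X * X), entourage U &
     forall x : X, precompact [set y | U (y, x)]) ->
  (forall (dA : Order.disp_t) (A : directedType dA)
     (x : A -> prod_topology (approximant P)),
     (forall a : A, inverse_limit P (x a)) ->
     (exists y : prod_topology (approximant P), x @ tails A --> y) ->
     exists2 l : prod_topology (approximant P),
       inverse_limit P l & x @ tails A --> l) ->
  complete_space (limit_space P).
Proof.
move=> hU hnet F FF cF.
have [G [GU FG]] := ultraFilterLemma FF.
have GF : ProperFilter G := @ultra_proper _ _ GU.
have lim l : exists k : approximant P l, limit_proj P l @ G --> k.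
  have [C Cc FC] := cauchy_limit_proj_compact hU FF cF l.
  by apply: (ultra_limit_proj_cvg _ Cc); exact: FG.
pose x (a : filter_net GF) : prod_topology (approximant P) :=
  set_val (net_point a).
have xE : x @ tails (filter_net GF) = set_val @ G.
  by rewrite -[in RHS](net_point_tails GF).
have [||y yP] := hnet _ _ x; first by move=> a; exact: set_mem (valP _).
  (* These limits are chosen one coordinate at a time. Without separation they need not be
     compatible with the bonds, so the hypothesis on nets replaces them by a point [y] of the
     inverse limit. *)
  exists (fun l => sval (cid (lim l))); rewrite xE.
  by apply/prod_topology_cvgP => l; exact: svalP (cid (lim l)).
rewrite xE => /prod_topology_cvgP Gy.
pose z : limit_space P := exist _ y (mem_set yP).
have /cvg_entourageP Gz : G --> z by apply: cvg_limit_space => l; exact: Gy.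
(* A Cauchy filter converges to any limit of a finer filter: a [D]-small set of [F] belongs to [G],
   hence contains a point [D]-close to [z]. *)
exists z; apply/cvg_entourageP => E entE.
have [D [entD _ _ DE]] := entourage_split_sym entE.
have /cauchyP/(_ _ entD)[A FA AD] := cF.
have [t [Dzt At]] := filter_ex (filterI (Gz _ entD) (FG _ FA)).
by apply: filterS FA => s As; apply: DE Dzt _; exact: AD.
Qed.

Lemma approximant_pi_inverse_limit (x : X) :
  inverse_limit P (fun l => approximant_pi P l x).
Proof. by move=> l m; exact: bondE. Qed.

Definition collage_limit_map (x : collage_space P) : limit_space P :=
  exist _ (fun l => approximant_pi P l x)
    (mem_set (approximant_pi_inverse_limit x)).

Lemma collage_limit_map_unif_continuous : unif_continuous collage_limit_map.
Proof.
move=> W [l [U entU UW]].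
have [U1 [entU1 _ U1sym U1U]] := entourage_split_sym entU.
have [m lm exm] := collage_exchange_pi l.
have [V entV VU1] := exm _ entU1.
(* Of the two outer steps, the first must lie in [V] for the exchange, and the second in [U1] to
   compose with the step that the exchange produces. *)
exists m; exists (V `&` U1); first exact: filterI.
move=> [x y] /= [z [w [Vxw _] /approximant_piP wz] [_ Uzy]].
have [t xt Utz] := VU1 _ _ _ Vxw wz.
apply: UW; exists (t, y); first exact: U1U Utz Uzy.
by congr pair.
Qed.

Lemma collage_limit_map_dense (x : limit_space P)
    (E : set (limit_space P * limit_space P)) :
  entourage E -> exists a, E (x, collage_limit_map a).
Proof.
move=> [l [U entU UE]]; have [a ax] := approximant_pi_surj (limit_proj P l x).
exists a; apply: UE; exists (a, a); first exact: entourage_refl.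
by congr pair.
Qed.

Lemma collage_limit_map_inducing
    (E : set (collage_space P * collage_space P)) :
  entourage E ->
  exists2 W, entourage W & pairmap collage_limit_map @^-1` W `<=` E.
Proof.
move=> [l [U entU UE]]; have [m lm exm] := collage_exchange_pi l.
have [V entV VU] := exm _ entU.
exists (pairmap (limit_proj P m) @^-1` (pairmap (approximant_pi P m) @` V)).
  by exists m; exists V.
move=> [x y] [[a b] Vab [ax by_]]; apply: UE.
have [w aw Uwy] := VU _ _ _ Vab by_.
(* One exchange already gives an identification followed by a [U]-step, so the first outer step is
   taken trivial. *)
exists w => //; exists x; first exact: entourage_refl.
apply/approximant_piP; rewrite -aw -(bondE P x lm) -(bondE P a lm).
by rewrite -[approximant_pi P m x]ax.
Qed.

(** The bonds are continuous and limits in Hausdorff approximants are unique, so the compatibility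
    equations pass to the limit. *)
Lemma inverse_limit_cvg (dA : Order.disp_t) (A : directedType dA)
    (x : A -> prod_topology (approximant P))
    (y : prod_topology (approximant P)) :
  (forall l, hausdorff_space (approximant P l)) ->
  (forall a, inverse_limit P (x a)) -> x @ tails A --> y -> inverse_limit P y.
Proof.
move=> hK xP /prod_topology_cvgP xy l m lm.
apply: (@cvg_unique _ (hK l) ((fun a => x a l) @ tails A)); last exact: xy.
rewrite (_ : (fun a => x a l) = @bond _ _ _ P l m \o (fun a => x a m)).
  by apply: continuous_cvg (xy m); exact: bond_continuous.
by apply/funext => a /=; rewrite xP.
Qed.

End CollageLimit.

Theorem theorem2p2p22 (X : uniformType) (d : Order.disp_t)
    (L : directedType d) (P : collage X L)
    (hU : exists2 U : set (X * X), entourage U &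
            forall x : X, precompact [set y | U (y, x)]) :
  ((forall (dA : Order.disp_t) (A : directedType dA)
       (x : A -> prod_topology (approximant P)),
       (forall a : A, inverse_limit P (x a)) ->
       (exists y : prod_topology (approximant P), x @ tails A --> y) ->
       exists2 l : prod_topology (approximant P),
         inverse_limit P l & x @ tails A --> l) ->
    is_completion (collage_space P) (limit_space P)) /\
  ((forall l : L, hausdorff_space (approximant P l)) ->
    is_completion (collage_space P) (limit_space P)).
Proof.
have main : (forall (dA : Order.disp_t) (A : directedType dA)
      (x : A -> prod_topology (approximant P)),
      (forall a : A, inverse_limit P (x a)) ->
      (exists y : prod_topology (approximant P), x @ tails A --> y) ->
      exists2 l : prod_topology (approximant P),
        inverse_limit P l & x @ tails A --> l) ->
    is_completion (collage_space P) (limit_space P).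
  move=> hnet; apply: completion_criterion.
  - exact: collage_limit_map_unif_continuous.
  - exact: limit_space_complete.
  - exact: collage_limit_map_dense.
  - exact: collage_limit_map_inducing.
split=> // hK; apply: main => dA A x xP [y xy]; exists y => //.
exact: inverse_limit_cvg xy.
Qed.
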